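(* Consider the networked system $\dot X=\Phi X$, $Y=\Psi X$ with $\Phi=I_N\otimes A+L\otimes H$ and $\Psi=\Delta\otimes C$, and let $\bar\Phi=I_N\otimes A+\bar L\otimes H$. The topological change $L\to\bar L$ is $\Psi$-discernible if and only if for all $\mu\in\sigma(\Phi)\cup\sigma(\bar\Phi)$ the following two conditions hold simultaneously: (1) $S(\mu|\Phi)\cap S(\mu|\bar\Phi)=\{\mathbf 0_{Nn}\}$; (2) $\mathcal N(\Psi)\cap\{S(\mu|\Phi)\oplus S(\mu|\bar\Phi)\}=\{\mathbf 0_{Nn}\}$.
   Context: Setting. $N\ge 2$; $A\in\mathbb R^{n\times n}$, $H\in\mathbb R^{n\times n}$, $C\in\mathbb R^{p\times n}$. $L=[w_{ij}]\in\mathbb R^{N\times N}$ is the weight matrix of a directed weighted graph on $N$ nodes, with $w_{ii}=0$ and $w_{ij}\ne 0$ exactly when there is an edge from node $j$ to node $i$ (weights are otherwise arbitrary real numbers). $\Delta=\mathrm{diag}\{\delta_1,\dots,\delta_N\}$ with $\delta_i=1$ if node $i$ is measured and $\delta_i=0$ otherwise. The networked system consists of $N$ nodes $\dot x_i=Ax_i+\sum_{j=1}^N w_{ij}Hx_j$, $y_i=Cx_i$, with stacked state $X=[x_1^T,\dots,x_N^T]^T\in\mathbb R^{Nn}$. A topological change replaces $L$ by another real $N\times N$ weight matrix $\bar L$ with zero diagonal (edges removed or added, or edge weights changed), giving the new system $\dot{\bar X}=\bar\Phi\bar X$, $\bar Y=\Psi\bar X$. $\otimes$ is the Kronecker product.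 Discernibility. A pair of initial states $(X_0,\bar X_0)\in\mathbb R^{Nn}\times\mathbb R^{Nn}$ is called $\Psi$-indiscernible with respect to $L\to\bar L$ if $\Psi e^{\Phi t}X_0=\Psi e^{\bar\Phi t}\bar X_0$ for all $t\ge 0$. The change $L\to\bar L$ is called $\Psi$-discernible if the only $\Psi$-indiscernible pair is the trivial one $(\mathbf 0_{Nn},\mathbf 0_{Nn})$; otherwise it is $\Psi$-indiscernible. Notation. For a square matrix $M$ of size $m$, $\sigma(M)$ is the set of its complex eigenvalues and $S(\mu|M)=\{x\in\mathbb C^m: Mx=\mu x\}$ (so $S(\mu|M)=\{\mathbf 0\}$ if $\mu\notin\sigma(M)$). $\mathcal N(\Psi)$ is the null space of $\Psi$, taken in $\mathbb C^{Nn}$. $V_1\oplus V_2$ is the (internal) direct sum of subspaces of $\mathbb C^{Nn}$, i.e. the sum $V_1+V_2$ when $V_1\cap V_2=\{\mathbf 0\}$; condition (1) ensures that the sum in (2) is direct. $\mathbf 0_{Nn}$ is the zero vector of length $Nn$. *)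

(* Defs.v *)
(* MathComp / MathComp-Analysis development; the real numbers are an arbitrary
   R : realType and the complex numbers are R[i] (mathcomp-real-closed). *)
From mathcomp Require Export all_boot all_order all_algebra.
From mathcomp Require Export all_classical all_reals all_analysis.
From mathcomp Require Export complex mxtens.

Set Implicit Arguments.
Unset Strict Implicit.
Unset Printing Implicit Defensive.

Export Order.TTheory GRing.Theory Num.Theory.
Export numFieldNormedType.Exports.

Local Open Scope classical_set_scope.
Local Open Scope ring_scope.

(* The limit is taken for the (entrywise) topology of 'M[R]_m. *)
Definition expmx (R : realType) (m : nat) (M : 'M[R]_m) : 'M[R]_m :=
  limn (series (fun k : nat => (k`!%:R : R)^-1 *: M ^+ k)).

(* A real matrix acting on complex column vectors. *)
Definition cmx_lin (R : realType) (q m : nat) (M : 'M[R]_(q, m)) :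
    'Hom('cV[R[i]]_m, 'cV[R[i]]_q) :=
  linfun (mulmx (map_mx (real_complex R) M)).

Definition eigspace (R : realType) (m : nat) (mu : R[i]) (M : 'M[R]_m) :
    {vspace 'cV[R[i]]_m} :=
  passmx.leigenspace (cmx_lin M) mu.

Definition spectrum (R : realType) (m : nat) (M : 'M[R]_m) : set R[i] :=
  [set mu | passmx.leigenvalue (cmx_lin M) mu].

Definition nullspace (R : realType) (q m : nat) (M : 'M[R]_(q, m)) :
    {vspace 'cV[R[i]]_m} :=
  lker (cmx_lin M).

Lemma mem_eigspace (R : realType) (m : nat) (mu : R[i]) (M : 'M[R]_m)
    (x : 'cV[R[i]]_m) :
  (x \in eigspace mu M) = (map_mx (real_complex R) M *m x == mu *: x).
Proof.
rewrite memv_ker add_lfunE opp_lfunE scale_lfunE id_lfunE subr_eq0.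
by rewrite [cmx_lin M x]lfunE.
Qed.

Lemma mem_nullspace (R : realType) (q m : nat) (M : 'M[R]_(q, m))
    (x : 'cV[R[i]]_m) :
  (x \in nullspace M) = (map_mx (real_complex R) M *m x == 0).
Proof. by rewrite memv_ker lfunE. Qed.

Lemma spectrumP (R : realType) (m : nat) (M : 'M[R]_m) (mu : R[i]) :
  spectrum M mu <->
  exists2 x : 'cV[R[i]]_m, x != 0 & map_mx (real_complex R) M *m x = mu *: x.
Proof.
rewrite /spectrum /= /passmx.leigenvalue -/(eigspace mu M); split.
  move=> S_neq0; exists (vpick (eigspace mu M)); first by rewrite vpick0.
  by apply/eqP; rewrite -mem_eigspace memv_pick.
move=> [x x_neq0 /eqP]; rewrite -mem_eigspace => xS.
by apply: contraNneq x_neq0 => S0; rewrite -memv0 -S0.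
Qed.

(* [D] is the set of measured nodes. *)
Definition measure_mx (R : realType) (N : nat) (D : {set 'I_N}) : 'M[R]_N :=
  diag_mx (\row_(i < N) ((i \in D)%:R : R)).

(* [tensmx] is the Kronecker product: row (i, k) of [A *t B] is row
   i * (height of B) + k, so the state is the stack of the N node states. *)
Definition net_mx (R : realType) (N n : nat) (A H : 'M[R]_n) (L : 'M[R]_N) :
    'M[R]_(N * n) :=
  tensmx (1%:M : 'M[R]_N) A + tensmx L H.

Definition out_mx (R : realType) (N n p : nat) (D : {set 'I_N})
    (C : 'M[R]_(p, n)) : 'M[R]_(N * p, N * n) :=
  tensmx (measure_mx R D) C.

Definition indiscernible_pair (R : realType) (q m : nat) (Psi : 'M[R]_(q, m))
    (Phi Phib : 'M[R]_m) (X : 'cV[R]_m * 'cV[R]_m) : Prop :=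
  forall t : R, 0 <= t ->
    Psi *m expmx (t *: Phi) *m X.1 = Psi *m expmx (t *: Phib) *m X.2.

Definition discernible (R : realType) (q m : nat) (Psi : 'M[R]_(q, m))
    (Phi Phib : 'M[R]_m) : Prop :=
  forall X : 'cV[R]_m * 'cV[R]_m,
    indiscernible_pair Psi Phi Phib X <-> X = (0, 0).

(* Main.v *)
Require Import Defs.
From HB Require Import structures.
From mathcomp Require Import ring lra.

Set Implicit Arguments.
Unset Strict Implicit.
Unset Printing Implicit Defensive.

(** Put the two systems side by side and observe the difference of their outputs:
    the pair of initial states is indiscernible exactly when it is an unobservable
    state of this direct sum, so the criterion is the Popov-Belevitch-Hautus
    eigenvector test for [diag(Phi, Phib)] with output [[Psi, -Psi]].

    First, the outputs agree for all times iff [Psi Phi^k X = Psi Phib^k Xb] for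
    all [k] ([indiscernible_pairP]), because the entries of an output are
    everywhere convergent power series in the time ([pseries_expmx]) and such a
    series vanishes on the nonnegative half-line only if its coefficients do
    ([pseries_eq0]).

    Second, a nonzero vector with this property produces, over the algebraically
    closed field of complex numbers, an eigenvector with the same property
    ([unobservable_eigenvector]).  Hence the change is discernible iff, for every
    [mu], no [(x, y) <> (0, 0)] with [Phi x = mu x] and [Phib y = mu y] satisfies
    [Psi x = Psi y] ([discernibleP]); real initial states come back as real and
    imaginary parts of [x] and [y].

    Third, [Psi (x - y) = 0] with [(x, y) <> (0, 0)] happens either with [x = y], a
    nonzero vector common to both eigenspaces, or with [x - y] a nonzero
    element of their sum in the kernel of [Psi]: these are the two conditions
    of the criterion ([discernible_eigspaceP]). *)

Local Open Scope classical_set_scope.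
Local Open Scope ring_scope.

(** * Convergence of the matrix exponential *)

(** Joins the completeness and the normed-module structures of matrix spaces,
    so that absolute convergence of a series of matrices implies convergence. *)
HB.instance Definition _ (R : realType) (m n : nat) :=
  Complete.on 'M[R]_(m, n).

(** The norm is the largest absolute value of an entry, which is submultiplicative
    only up to the inner dimension: an entry of the product has [n] summands. *)
Lemma normmx_mul (R : realType) (m n p : nat) (A : 'M[R]_(m, n))
    (B : 'M[R]_(n, p)) : `|A *m B| <= n%:R * `|A| * `|B|.
Proof.
have entry (q r : nat) (M : 'M[R]_(q, r)) i j : `|M i j| <= `|M|.
  rewrite [leRHS]mx_normrE.
  exact: (le_bigmax _ (fun ij => `|M ij.1 ij.2|) (i, j)).
rewrite [leLHS]mx_normrE; apply: bigmax_le => [|[i j] _ /=].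
  by rewrite !mulr_ge0.
rewrite mxE (le_trans (ler_norm_sum _ _ _))//.
have -> : n%:R * `|A| * `|B| = \sum_(k < n) `|A| * `|B|.
  by rewrite sumr_const card_ord -mulrA mulr_natl.
by apply: ler_sum => k _; rewrite normrM ler_pM.
Qed.

Lemma normmx_exp (R : realType) (m : nat) (M : 'M[R]_m) (k : nat) :
  `|M ^+ k| <= (m%:R * `|M|) ^+ k.
Proof.
elim: k => [|k IH].
  rewrite !expr0 [leLHS]mx_normrE; apply: bigmax_le => // -[i j] _ /=.
  by rewrite [X in X i j]/1 /= mxE; case: (i == j); rewrite ?normr1 ?normr0.
rewrite exprS [leRHS]exprS (le_trans (normmx_mul _ _)) //.
by rewrite ler_wpM2l // mulr_ge0.
Qed.

(** The series is dominated in norm by the exponential series of [m * |M|], so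
    the limit that defines [expmx] is a genuine one. *)
Lemma cvg_expmx (R : realType) (m : nat) (M : 'M[R]_m) :
  series (fun k : nat => (k`!%:R : R)^-1 *: M ^+ k) @ \oo --> expmx M.
Proof.
apply: normed_cvg.
apply: series_le_cvg (is_cvg_series_exp_coeff (m%:R * `|M|)) => k //=.
  by rewrite /exp_coeff /= mulr_ge0 ?invr_ge0 ?exprn_ge0 // mulr_ge0.
rewrite normrZ ger0_norm ?invr_ge0 // mulrC.
by rewrite /exp_coeff /= ler_pM ?invr_ge0 // normmx_exp.
Qed.
Arguments cvg_expmx {R m} M.

Lemma cvg_mulmx_entry (R : realType) (q m r : nat) (P : 'M[R]_(q, m))
    (Q : 'M[R]_(m, r)) (i : 'I_q) (j : 'I_r) (u : nat -> 'M[R]_m) (E : 'M[R]_m) :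
  u @ \oo --> E -> (P *m u n *m Q) i j @[n --> \oo] --> (P *m E *m Q) i j.
Proof.
move=> uE.
have entryE (F : 'M[R]_m) :
    (P *m F *m Q) i j = \sum_l (\sum_k P i k * F k l) * Q l j.
  by rewrite mxE; apply: eq_bigr => l _; rewrite mxE.
rewrite entryE; under eq_fun do rewrite entryE.
apply: cvg_big => [|l _]; first exact: add_continuous.
apply: cvgM; last exact: cvg_cst.
apply: cvg_big => [|k _]; first exact: add_continuous.
apply: cvgM; first exact: cvg_cst.
apply: (continuous_cvg _ (h := fun F : 'M[R]_m => F k l) _ uE).
exact: coord_continuous.
Qed.
Arguments cvg_mulmx_entry {R q m r} P Q i j {u E}.

(** Each entry of an output trajectory is a power series in the time, whose
    coefficients are the entries of [P M^k Q] over [k!]; this reduces equality of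
    trajectories to a question on scalar power series. *)
Lemma pseries_expmx (R : realType) (q m r : nat) (P : 'M[R]_(q, m))
    (M : 'M[R]_m) (Q : 'M[R]_(m, r)) (i : 'I_q) (j : 'I_r) (t : R) :
  pseries (fun k => (k`!%:R)^-1 * (P *m M ^+ k *m Q) i j) t @ \oo -->
    (P *m expmx (t *: M) *m Q) i j.
Proof.
have := cvg_mulmx_entry P Q i j (cvg_expmx (t *: M)).
apply: cvg_trans; apply: near_eq_cvg; near=> n => /=.
rewrite /pseries /series /= !big_mkord mulmx_sumr mulmx_suml summxE.
apply: eq_bigr => k _.
have -> : (t *: M) ^+ k = t ^+ k *: M ^+ k.
  elim: (k : nat) => [|l IH]; first by rewrite !expr0 scale1r.
  by rewrite !exprS IH -!mulmxE -scalemxAl -scalemxAr scalerA.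
by rewrite scalerA -scalemxAr -scalemxAl mxE mulrAC mulrC mulrA.
Unshelve. all: by end_near. Qed.
Arguments pseries_expmx {R q m r} P M Q i j t.

(** * Uniqueness of power series coefficients *)

(** Let [a k] be the first coefficient that could be nonzero.  For [0 < t <= 1]
    the rest of the series is at most [t^(k+1) * S], where [S], the sum of the
    [|a i|], is finite because the series also converges at 2.  As the whole sum
    is 0, [|a k| <= t * S], which forces [a k = 0] when [t] tends to 0. *)
Lemma pseries_eq0 (R : realType) (a : nat -> R) :
  (forall t : R, 0 <= t -> pseries a t @ \oo --> (0 : R)) ->
  forall k, a k = 0.
Proof.
move=> a0; elim/ltn_ind => k IH.
pose S : R := limn (pseries (fun i => `|a i|) 1).
have cS : cvgn (pseries (fun i => `|a i|) 1).
  apply: (@is_cvg_pseries_inside_norm _ a 2); last by rewrite normr1 gtr0_norm ?ltr1n.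
  by apply/cvg_ex; exists 0; exact: a0.
have partial_le n : \sum_(i < n) `|a i| <= S.
  rewrite (_ : \sum_(i < n) _ = pseries (fun i => `|a i|) 1 n).
    apply: nondecreasing_cvgn_le => //; apply: nondecreasing_series => l _ _.
    by rewrite mulr_ge0 ?exprn_ge0.
  by rewrite /pseries /series /= big_mkord; apply: eq_bigr => l _; rewrite expr1n mulr1.
have step (t : R) : 0 < t -> t <= 1 -> `|a k| <= t * S.
  move=> t0 t1.
  have : `|0 - a k * t ^+ k| <= t ^+ k.+1 * S.
    apply: (@cvgr_to_le _ \oo _ _ (fun n => `|pseries a t n - a k * t ^+ k|)).
      have lim_a : pseries a t n - a k * t ^+ k @[n --> \oo] --> 0 - a k * t ^+ k.
        by apply: cvgB; [apply: a0; exact: ltW|exact: cvg_cst].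
      exact: cvg_norm lim_a.
    near=> n.
    have kn : (k < n)%N by near: n; exact: nbhs_infty_gt.
    rewrite /pseries /series /= big_mkord (bigD1 (Ordinal kn)) //= addrAC subrr add0r.
    rewrite (le_trans (ler_norm_sum _ _ _)) //.
    have tS : t ^+ k.+1 * \sum_(i < n) `|a i| <= t ^+ k.+1 * S.
      by rewrite ler_wpM2l ?exprn_ge0 // ltW.
    apply: le_trans tS; rewrite mulr_sumr [leRHS](bigD1 (Ordinal kn)) //=.
    rewrite ler_wpDl ?mulr_ge0 ?exprn_ge0 // ?(ltW t0) //.
    apply: ler_sum => l lk; rewrite normrM [leLHS]mulrC.
    have [lk'|] := ltnP l k; first by rewrite IH // normr0 !mulr0.
    rewrite leq_eqVlt => /orP[/eqP kl|kl].
      by move: lk; rewrite -val_eqE /= -kl eqxx.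
    rewrite ler_wpM2r // ger0_norm ?exprn_ge0 ?(ltW t0) //.
    by rewrite ler_wiXn2l // ltW.
  rewrite sub0r normrN normrM (ger0_norm (exprn_ge0 _ (ltW t0))) exprS.
  by rewrite mulrAC ler_pM2r // exprn_gt0.
apply: contrapT => /eqP ak0.
have aS : `|a k| <= S by have := step 1 ltr01 (lexx _); rewrite mul1r.
have ak_gt0 : 0 < `|a k| by rewrite normr_gt0.
have S0 : 0 < S by exact: lt_le_trans aS.
(* This [t] turns the bound [t * S] into [|a k| / 2]. *)
have := step (`|a k| / (2 * S)).
rewrite divr_gt0 ?mulr_gt0 // ler_pdivrMr ?mulr_gt0 // mul1r.
have -> : `|a k| / (2 * S) * S = `|a k| / 2 by field; rewrite gt_eqF.
move=> /(_ isT) h.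
have : `|a k| <= `|a k| / 2 by apply: h; lra.
lra.
Unshelve. all: by end_near. Qed.

(** * Unobservable states and eigenvectors *)

(** The eigenvector half of the Popov-Belevitch-Hautus test.  By Cayley-Hamilton,
    the product of the [M - z] over the roots [z] of the characteristic polynomial
    kills [v].  Applying these factors to [v] one at a time, the last vector
    before 0 is an eigenvector, and it has the form [p(M) v], hence is
    unobservable like [v]. *)
Lemma unobservable_eigenvector (F : closedFieldType) (q m : nat)
    (O : 'M[F]_(q, m)) (M : 'M[F]_m) (v : 'cV[F]_m) :
  v != 0 -> (forall k, O *m M ^+ k *m v = 0) ->
  exists mu : F, exists w : 'cV[F]_m,
    [/\ w != 0, M *m w = mu *: w & O *m w = 0].
Proof.
move: O M v; case: m => [|m] O M v; first by rewrite [v]flatmx0 eqxx.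
move=> v0 Ov.
have [s chiE] := closed_field_poly_normal (char_poly M).
rewrite (monicP (char_poly_monic M)) scale1r in chiE.
have : horner_mx M (\prod_(z <- s) ('X - z%:P)) *m v = 0.
  by rewrite -chiE Cayley_Hamilton mul0mx.
(* The vector varies: one factor is applied to it at each step. *)
elim: s v v0 Ov {chiE} => [|a s IH] v v0 Ov.
  by rewrite big_nil rmorph1 mul1mx => /eqP; rewrite (negPf v0).
rewrite big_cons mulrC rmorphM /= rmorphB /= horner_mx_X horner_mx_C -mulmxA.
have [w0 _|w0 sw] := eqVneq ((M - a%:M) *m v) 0.
  exists a, v; split=> //; last by have := Ov 0; rewrite expr0 mulmx1.
  by apply/eqP; rewrite -subr_eq0 -mul_scalar_mx -mulmxBl w0.
apply: IH sw => // k.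
rewrite mulmxBl mul_scalar_mx mulmxBr -scalemxAr Ov scaler0 subr0.
by rewrite !mulmxA -(mulmxA O) mulmxE -exprSr Ov.
Qed.

Lemma exp_block_diag_mx (F : pzRingType) (m1 m2 : nat) (A : 'M[F]_m1)
    (B : 'M[F]_m2) (k : nat) :
  block_mx A 0 0 B ^+ k = block_mx (A ^+ k) 0 0 (B ^+ k).
Proof.
elim: k => [|k IH]; first by rewrite !expr0 -scalar_mx_block.
by rewrite !exprS IH -!mulmxE mulmx_block !mulmx0 !mul0mx !addr0 !add0r.
Qed.

Lemma map_mx_exp (F G : nzRingType) (f : {rmorphism F -> G}) (m : nat)
    (M : 'M[F]_m) (k : nat) : map_mx f (M ^+ k) = map_mx f M ^+ k.
Proof.
elim: k => [|k IH]; first by rewrite !expr0 map_mx1.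
by rewrite !exprS -!mulmxE map_mxM IH.
Qed.

(** Real and imaginary parts commute with real matrices, so a complex mode splits
    into two real pairs of states. *)
Lemma map_Re_mulmx (R : realType) (q m : nat) (M : 'M[R]_(q, m))
    (z : 'cV[R[i]]_m) :
  map_mx (@complex.Re R) (map_mx (real_complex R) M *m z) =
  M *m map_mx (@complex.Re R) z.
Proof.
apply/matrixP => i j; rewrite !mxE.
rewrite (big_morph (@complex.Re R) (id1 := 0) (op1 := +%R)) //; last first.
  by case=> ? ? [].
by apply: eq_bigr => k _; rewrite !mxE; case: (z k j) => a b /=; rewrite mul0r subr0.
Qed.

Lemma map_Im_mulmx (R : realType) (q m : nat) (M : 'M[R]_(q, m))
    (z : 'cV[R[i]]_m) :
  map_mx (@complex.Im R) (map_mx (real_complex R) M *m z) =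
  M *m map_mx (@complex.Im R) z.
Proof.
apply/matrixP => i j; rewrite !mxE.
rewrite (big_morph (@complex.Im R) (id1 := 0) (op1 := +%R)) //; last first.
  by case=> ? ? [].
by apply: eq_bigr => k _; rewrite !mxE; case: (z k j) => a b /=; rewrite mul0r addr0.
Qed.

Lemma map_Re_Im_eq0 (R : realType) (m : nat) (z : 'cV[R[i]]_m) :
  map_mx (@complex.Re R) z = 0 -> map_mx (@complex.Im R) z = 0 -> z = 0.
Proof.
move=> /matrixP re0 /matrixP im0; apply/matrixP => i j.
have := re0 i j; have := im0 i j; rewrite !mxE.
by case: (z i j) => a b /= -> ->.
Qed.

(** * Discernibility *)

(** Equal trajectories have equal Taylor coefficients at time 0, and conversely
    the Taylor coefficients determine the exponentials. *)
Lemma indiscernible_pairP (R : realType) (q m : nat) (Psi : 'M[R]_(q, m))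
    (Phi Phib : 'M[R]_m) (X : 'cV[R]_m * 'cV[R]_m) :
  indiscernible_pair Psi Phi Phib X <->
  forall k, Psi *m Phi ^+ k *m X.1 = Psi *m Phib ^+ k *m X.2.
Proof.
split=> [indX k|markov t _].
  apply/matrixP => i j.
  pose a (M : 'M[R]_m) (Y : 'cV[R]_m) k :=
    (k`!%:R)^-1 * (Psi *m M ^+ k *m Y) i j.
  suff /(_ k)/eqP : forall l, a Phi X.1 l - a Phib X.2 l = 0.
    rewrite subr_eq0 /a => /eqP; apply: mulfI.
    by rewrite invr_neq0 // pnatr_eq0 -lt0n fact_gt0.
  apply: (pseries_eq0 (a := fun l => a Phi X.1 l - a Phib X.2 l)) => t t0.
  have -> : pseries (fun l => a Phi X.1 l - a Phib X.2 l) t =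
            pseries (a Phi X.1) t - pseries (a Phib X.2) t.
    apply/funext => n; rewrite /pseries /series !fctE /= -sumrB.
    by apply: eq_bigr => l _; rewrite mulrBl.
  (* Both output series converge to the same value, so their difference tends to 0. *)
  rewrite -[0](subrr ((Psi *m expmx (t *: Phi) *m X.1) i j)).
  by apply: cvgB; [|rewrite indX //]; exact: pseries_expmx.
apply/matrixP => i j.
have := pseries_expmx Psi Phi X.1 i j t.
under eq_fun do rewrite markov.
by move=> /(cvg_unique (@Rhausdorff R)); apply; exact: pseries_expmx.
Qed.

Local Notation cplx := (map_mx (real_complex _)).

(** Indiscernible pairs are the unobservable states of the direct sum of the two
    systems, observed through the difference of their outputs.  A nonzero one
    yields an unobservable complex eigenvector of the direct sum, that is, two
    modes for a common [mu] with the same output, one of them possibly zero.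
    Conversely, such modes have outputs with the same Taylor coefficients
    [mu^k Psi x = mu^k Psi y], and so do their real and imaginary parts. *)
Lemma discernibleP (R : realType) (q m : nat) (Psi : 'M[R]_(q, m))
    (Phi Phib : 'M[R]_m) :
  discernible Psi Phi Phib <->
  forall (mu : R[i]) (x y : 'cV[R[i]]_m),
    cplx Phi *m x = mu *: x -> cplx Phib *m y = mu *: y ->
    cplx Psi *m x = cplx Psi *m y -> x = 0 /\ y = 0.
Proof.
split=> [disc mu x y Phix Phiby Psixy|modes [X Xb]].
  have powE (M : 'M[R]_m) (z : 'cV[R[i]]_m) k :
      cplx M *m z = mu *: z -> cplx (M ^+ k) *m z = mu ^+ k *: z.
    move=> Mz; elim: k => [|k IH].
      by rewrite !expr0 map_mx1 mul1mx scale1r.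
    by rewrite exprSr -mulmxE map_mxM -mulmxA Mz -scalemxAr IH scalerA -exprS.
  have markov k : cplx (Psi *m Phi ^+ k) *m x = cplx (Psi *m Phib ^+ k) *m y.
    by rewrite !map_mxM -!mulmxA !powE // -!scalemxAr Psixy.
  have [] : (map_mx (@complex.Re R) x, map_mx (@complex.Re R) y) = (0, 0).
    apply/disc/indiscernible_pairP => k /=.
    by rewrite -!map_Re_mulmx markov.
  have [] : (map_mx (@complex.Im R) x, map_mx (@complex.Im R) y) = (0, 0).
    apply/disc/indiscernible_pairP => k /=.
    by rewrite -!map_Im_mulmx markov.
  by move=> imx imy rex rey; split; apply: map_Re_Im_eq0.
split=> [/indiscernible_pairP /= markov|[-> ->] t _ /=]; last by rewrite !mulmx0.
apply/eqP; apply: contraT => XXb.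
pose v : 'cV[R[i]]_(m + m) := col_mx (cplx X) (cplx Xb).
have [||mu [w [w0 Mw Ow]]] := @unobservable_eigenvector _ _ _
  (row_mx (cplx Psi) (- cplx Psi)) (block_mx (cplx Phi) 0 0 (cplx Phib)) v.
- apply: contra_neq XXb => /eqP; rewrite col_mx_eq0 !map_mx_eq0.
  by move=> /andP[/eqP -> /eqP ->].
- move=> k; rewrite exp_block_diag_mx mul_row_block mul_row_col !mulmx0 addr0 add0r.
  by rewrite mulNmx -!map_mx_exp -!map_mxM mulNmx -!map_mxM markov subrr.
move: w0 Mw Ow; rewrite -[w]vsubmxK mul_block_col !mul0mx addr0 add0r scale_col_mx.
move=> w0 /eq_col_mx[Phix Phiby]; rewrite mul_row_col mulNmx => /eqP.
rewrite subr_eq0 => /eqP /(modes _ _ _ Phix Phiby)[x0 y0].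
by move: w0; rewrite x0 y0 col_mx0 eqxx.
Qed.

Lemma vspace_eq0P (K : fieldType) (vT : vectType K) (U : {vspace vT}) :
  U = 0%VS <-> forall u, u \in U -> u = 0.
Proof.
split=> [-> u|U0]; first by rewrite memv0 => /eqP.
by apply/eqP; rewrite -subv0; apply/subvP => u /U0 ->; rewrite mem0v.
Qed.

Lemma eigspaceP (R : realType) (m : nat) (mu : R[i]) (M : 'M[R]_m)
    (x : 'cV[R[i]]_m) :
  reflect (map_mx (real_complex R) M *m x = mu *: x) (x \in eigspace mu M).
Proof. by rewrite mem_eigspace; apply: eqP. Qed.

Lemma nullspaceP (R : realType) (q m : nat) (M : 'M[R]_(q, m))
    (x : 'cV[R[i]]_m) :
  reflect (map_mx (real_complex R) M *m x = 0) (x \in nullspace M).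
Proof. by rewrite mem_nullspace; apply: eqP. Qed.

(** Two modes [x] and [y] for a common [mu] have the same output iff [x - y] is in
    the kernel of [Psi].  When the eigenspaces meet only at 0, a nonzero pair of
    modes has a nonzero difference, and the trivial intersection with the kernel
    says that every such difference is observed.  Only the two spectra matter,
    as [x = y = 0] for any other [mu]. *)
Lemma discernible_eigspaceP (R : realType) (q m : nat) (Psi : 'M[R]_(q, m))
    (Phi Phib : 'M[R]_m) :
  discernible Psi Phi Phib <->
  forall mu : R[i], (spectrum Phi `|` spectrum Phib) mu ->
    (eigspace mu Phi :&: eigspace mu Phib)%VS = 0%VS /\
    (nullspace Psi :&: (eigspace mu Phi + eigspace mu Phib))%VS = 0%VS.
Proof.
apply: (iff_trans (discernibleP Psi Phi Phib)).
split=> [modes mu _|crit mu x y Phix Phiby Psixy].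
  split; apply/vspace_eq0P => z; rewrite memv_cap.
    move=> /andP[/eigspaceP Phiz /eigspaceP Phibz].
    by have [] := modes mu z z Phiz Phibz erefl.
  move=> /andP[/nullspaceP Psiz /memv_addP[x /eigspaceP Phix]].
  move=> [y /eigspaceP Phiby zE].
  (* The decomposition of [z] is a sum, while modes are compared by difference. *)
  have [|| x0 /eqP] := modes mu x (- y) Phix.
  - by rewrite mulmxN Phiby scalerN.
  - by apply/eqP; rewrite mulmxN -addr_eq0 -mulmxDr -zE Psiz.
  by rewrite oppr_eq0 => /eqP y0; rewrite zE x0 y0 addr0.
suff xy0 : (spectrum Phi `|` spectrum Phib) mu -> x = 0 /\ y = 0.
  have [x0|x_neq0] := eqVneq x 0; last first.
    by apply: xy0; left; apply/spectrumP; exists x.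
  have [y0|y_neq0] := eqVneq y 0; first by split.
  by apply: xy0; right; apply/spectrumP; exists y.
move=> /crit[/vspace_eq0P cap0 /vspace_eq0P null0].
have xS : x \in eigspace mu Phi by exact/eigspaceP.
have yS : y \in eigspace mu Phib by exact/eigspaceP.
have ySN : - y \in eigspace mu Phib.
  by apply/eigspaceP; rewrite mulmxN Phiby scalerN.
have xyN : x - y \in nullspace Psi.
  by apply/nullspaceP; rewrite mulmxBr Psixy subrr.
have xy : x = y.
  apply/eqP; rewrite -subr_eq0; apply/eqP/null0; rewrite memv_cap.
  by apply/andP; split=> //; exact: memv_add xS ySN.
have xSb : x \in eigspace mu Phib by rewrite xy; exact: yS.
have x0 : x = 0.
  by apply: cap0; rewrite memv_cap; apply/andP; split; [exact: xS|exact: xSb].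
by rewrite -xy.
Qed.

Theorem theorem1 (R : realType) (N n p : nat) (hN : (2 <= N)%N)
    (A H : 'M[R]_n) (C : 'M[R]_(p, n)) (D : {set 'I_N})
    (L Lb : 'M[R]_N)
    (hL : forall i : 'I_N, L i i = 0) (hLb : forall i : 'I_N, Lb i i = 0) :
  let Phi := net_mx A H L in
  let Phib := net_mx A H Lb in
  let Psi := out_mx D C in
  discernible Psi Phi Phib <->
  forall mu : R[i], (spectrum Phi `|` spectrum Phib) mu ->
    (eigspace mu Phi :&: eigspace mu Phib)%VS = 0%VS /\
    (nullspace Psi :&: (eigspace mu Phi + eigspace mu Phib))%VS = 0%VS.
Proof. by move=> Phi Phib Psi; exact: discernible_eigspaceP. Qed.
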